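(* Let $A$ be a finite alphabet and let the subshift $\Sigma\subseteq A^\omega$ be a Möbius number system for a Möbius iterative system $\{F_a:a\in A\}$. Then for all finite alphabets $B$ and all substitution maps $\psi:B^\omega\to A^\omega$ we have $\Sigma\neq\psi(B^\omega)$.
   Context: $\mathbb{T}$ is the unit circle in $\mathbb{C}$. A disc preserving Möbius transformation is a map $F(z)=\frac{\alpha z+\beta}{\overline\beta z+\overline\alpha}$ with $|\alpha|^2-|\beta|^2=1$. $A^+$ is the set of nonempty finite words over $A$ and $A^\omega$ the set of one-sided infinite words with the product topology; $w_{[0,n)}=w_0\cdots w_{n-1}$. A subshift is a closed set $\Sigma\subseteq A^\omega$ with $\sigma(\Sigma)\subseteq\Sigma$, where $\sigma(w)_i=w_{i+1}$. A (non-erasing) substitution is any map $\psi:B\to A^+$; it extends to the substitution map $\psi:B^\omega\to A^\omega$ by concatenation, $\psi(u_0u_1u_2\cdots)=\psi(u_0)\psi(u_1)\psi(u_2)\cdots$. A Möbius iterative system is a family $\{F_a:a\in A\}$ of disc preserving Möbius transformations. For $v=v_0\cdots v_{n-1}$ put $F_v=F_{v_0}\circ\cdots\circ F_{v_{n-1}}$. A sequence $\{G_n\}$ of disc preserving Möbius transformations represents $x\in\mathbb{T}$ if $G_n\mu\to\delta_x$ weakly$^*$, where $\mu$ is the uniform probability measure on $\mathbb{T}$ and $G\mu(E)=\mu(G^{-1}(E))$. For $w\in A^\omega$, $\Phi(w)$ is the point $x\in\mathbb{T}$ represented by $\{F_{w_{[0,n)}}\}_{n=1}^\infty$ if it exists,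 and is undefined otherwise. A subshift $\Sigma\subseteq A^\omega$ is a Möbius number system for $\{F_a\}$ if $\Phi$ is defined on all of $\Sigma$, $\Phi(\Sigma)=\mathbb{T}$ and $\Phi|_{\Sigma}$ is continuous. *)

(* Defs.v *)
From HB Require Import structures.
From mathcomp Require Import all_boot all_order all_algebra.
From mathcomp Require Import complex.
From mathcomp Require Import all_classical all_reals all_analysis.
From mathcomp Require Import measurable_realfun.

Set Implicit Arguments.
Unset Strict Implicit.
Unset Printing Implicit Defensive.

Import Order.TTheory GRing.Theory Num.Theory.
Import numFieldNormedType.Exports.

Local Open Scope classical_set_scope.
Local Open Scope complex_scope.
Local Open Scope ring_scope.

Definition unit_circle (R : realType) : set R[i]^o := [set z | `|z| = 1].

Arguments unit_circle : clear implicits.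

(* The type of points of the unit circle, with the topology induced by the
   modulus on [R[i]] and the corresponding Borel sigma-algebra. *)
Definition circle (R : realType) : Type := unit_circle R.

HB.instance Definition _ (R : realType) := Choice.on (circle R).
HB.instance Definition _ (R : realType) := Uniform.on (circle R).

Coercion circle_val (R : realType) (z : circle R) : R[i] := val z.

Lemma circle_valP (R : realType) (z : circle R) : `|z : R[i]| = 1.
Proof. by have := valP z; rewrite inE. Qed.

Definition Circle (R : realType) (z : R[i]) (z1 : `|z| = 1) : circle R :=
  exist _ (z : R[i]^o) (mem_set z1).

HB.instance Definition _ (R : realType) :=
  isPointed.Build (circle R) (Circle (normr1 R[i])).

HB.instance Definition _ (R : realType) :=
  Measurable.copy (circle R) (g_sigma_algebraType (@open (circle R))).

(* [expi t = exp (i t)] *)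
Lemma expi_subproof (R : realType) (t : R) :
  `|cos t +i* sin t : R[i]| = 1.
Proof. by rewrite normc_def /= cos2Dsin2 sqrtr1. Qed.

Definition expi (R : realType) (t : measurableTypeR R) : circle R :=
  Circle (expi_subproof t).

Lemma continuous_expi (R : realType) : continuous (@expi R : R -> circle R).
Proof.
apply: (@continuous_comp_initial _ _ (R[i]^o) (@set_val _ (unit_circle R))).
have cC : continuous (fun t : R => t%:C : R[i]^o).
  move=> x; apply/(@cvgrPdist_lt _ R[i]^o) => e e0.
  have eE : (complex.Re e)%:C = e by apply: RRe_real; apply: gtr0_real.
  near=> t.
  rewrite -rmorphB normc_def /= expr0n addr0 sqrtr_sqr -eE ltcR.
  near: t; exists (complex.Re e) => //=; by rewrite -ltcR eE.

suff -> : @set_val _ (unit_circle R) \o @expi R =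
    (fun t => (cos t)%:C + 'i%C * (sin t)%:C : R[i]^o).
  move=> x; apply: (@cvgD R[i] R[i]^o).
    exact: continuous_comp (@continuous_cos R x) (cC _).
  apply: (@cvgM R[i]); first exact: cvg_cst.
  exact: continuous_comp (@continuous_sin R x) (cC _).
by apply/funext => t /=; rewrite set_valE /= [LHS]complexE.
Unshelve. all: by end_near.
Qed.

Lemma measurable_expi (R : realType) : measurable_fun setT (@expi R).
Proof.
apply: (@measurability _ _ _ _ _ _ (@open (circle R))) => //.
move=> _ [U oU <-]; rewrite setTI; apply: open_measurable.
by move/continuousP : (@continuous_expi R); exact.
Qed.

HB.instance Definition _ (R : realType) :=
  isMeasurableFun.Build _ _ _ _ (@expi R) (@measurable_expi R).

Lemma pi2_gt0 (R : realType) : 0 < pi *+ 2 :> R.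
Proof. by rewrite mulrn_wgt0 ?pi_gt0. Qed.

(* The uniform probability measure on the circle: the law of [exp (i t)] for
   [t] uniform on [[0, 2 pi]]. *)
Definition circle_prob (R : realType) : probability (circle R) R :=
  distribution (uniform_prob (pi2_gt0 R)) (@expi R).

(* A disc preserving Moebius transformation is determined by, and only used
   through, its action on the circle. The denominator does not vanish there
   ([mobius_denom_neq0]) and the quotient is again on the circle
   ([disc_mobius_ex]), so every admissible [alpha], [beta] gives such a map. *)
Definition disc_mobius (R : realType) (F : circle R -> circle R) :=
  exists alpha beta : R[i], `|alpha| ^+ 2 - `|beta| ^+ 2 = 1 /\
    forall z : circle R,
      F z = (alpha * z + beta) / (beta^*%C * z + alpha^*%C) :> R[i].

Lemma mobius_denom_neq0 (R : realType) (alpha beta : R[i]) (z : circle R) :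
  `|alpha| ^+ 2 - `|beta| ^+ 2 = 1 -> beta^*%C * z + alpha^*%C != 0.
Proof.
move=> ab1; rewrite addr_eq0; apply/eqP => /(congr1 (fun z => `|z|)).
rewrite normrM circle_valP mulr1 normrN !normcJ => ba.
by move/eqP: ab1; rewrite ba subrr eq_sym oner_eq0.
Qed.

Lemma disc_mobius_ex (R : realType) (alpha beta : R[i]) :
  `|alpha| ^+ 2 - `|beta| ^+ 2 = 1 ->
  exists F : circle R -> circle R, forall z : circle R,
    F z = (alpha * z + beta) / (beta^*%C * z + alpha^*%C) :> R[i].
Proof.
move=> ab1.
have F1 (z : circle R) :
    `|(alpha * z + beta) / (beta^*%C * z + alpha^*%C)| = 1.
  have d0 := mobius_denom_neq0 z ab1.
  have zz : (z : R[i]) * (z : R[i])^*%C = 1.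
    by rewrite -sqr_normc circle_valP expr1n.
  suff -> : alpha * z + beta = (z : R[i]) * (beta^*%C * z + alpha^*%C)^*%C.
    by rewrite normrM normrM normcJ circle_valP mul1r normfV divff// normr_eq0.
  rewrite rmorphD rmorphM /= !conjcK mulrDr addrC mulrCA zz mulr1.
  by congr (_ + _); rewrite mulrC.
by exists (fun z => Circle (F1 z)).
Qed.

(* [G n] represents [x] if the images [G n mu] of the uniform measure converge
   weakly* to the Dirac measure at [x]; [pushforward mu G E = mu (G @^-1` E)] *)
Definition represents (R : realType) (G : nat -> circle R -> circle R)
    (x : circle R) :=
  forall f : circle R -> R, continuous f ->
    (\int[pushforward (circle_prob R) (G n)]_z (f z)%:E)%E @[n --> \oo]
      --> (\int[\d_x]_z (f z)%:E)%E.

Definition infinite_word (A : finType) : Type :=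
  {ptws nat -> discrete_topology A}.

HB.instance Definition _ (A : finType) := Uniform.on (infinite_word A).

Definition shift (A : finType) (w : infinite_word A) : infinite_word A :=
  fun i => w i.+1.

Definition subshift (A : finType) (S : set (infinite_word A)) :=
  closed S /\ @shift A @` S `<=` S.

Definition word_prefix (A : finType) (w : infinite_word A) (n : nat) : seq A :=
  mkseq w n.

Definition nonempty_word (A : finType) : Type := {v : seq A | (0 < size v)%N}.

Definition first_letter (A : finType) (v : nonempty_word A) : A :=
  tnth (in_tuple (val v)) (Ordinal (valP v)).

(* The [i]-th letter of [psi (u 0) psi (u 1) psi (u 2) ...]. It is read off
   [psi (u 0) ... psi (u i)], which has length at least [i.+1], so the default
   value of [nth] is irrelevant; see [substitution_map_prefix]. *)
Definition substitution_map (A B : finType) (psi : B -> nonempty_word A)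
    (u : infinite_word B) : infinite_word A :=
  fun i => nth (first_letter (psi (u 0)))
             (flatten [seq val (psi b) | b <- word_prefix u i.+1]) i.

Lemma substitution_map_prefix (A B : finType) (psi : B -> nonempty_word A)
    (u : infinite_word B) (n : nat) :
  let v := flatten [seq val (psi b) | b <- word_prefix u n] in
  (n <= size v)%N /\ word_prefix (substitution_map psi u) (size v) = v.
Proof.
pose V n := flatten [seq val (psi b) | b <- word_prefix u n].
have VS m : V m.+1 = V m ++ val (psi (u m)).
  by rewrite /V /word_prefix mkseqS map_rcons flatten_rcons.
have szV m : (m <= size (V m))%N.
  elim: m => // m IH; rewrite VS size_cat.
  by rewrite -addn1 leq_add// (valP (psi (u m))).
have Vk m k : exists s, V (m + k)%N = V m ++ s.
  elim: k => [|k [s IH]]; first by exists [::]; rewrite addn0 cats0.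
  by exists (s ++ val (psi (u (m + k)%N))); rewrite addnS VS IH catA.
rewrite /= -/(V n); split=> //.
apply: (@eq_from_nth _ (first_letter (psi (u 0)))); rewrite size_mkseq// => i iV.
rewrite nth_mkseq// /substitution_map -/(V i.+1).
have [ni|/ltnW ni] := leqP n i.+1.
  have [s] := Vk n (i.+1 - n)%N.
  by rewrite subnKC// => ->; rewrite nth_cat iV.
have [s] := Vk i.+1 (n - i.+1)%N.
by rewrite subnKC// => ->; rewrite nth_cat szV.
Qed.

Definition mobius_iterative_system (R : realType) (A : finType)
    (F : A -> circle R -> circle R) :=
  forall a, disc_mobius (F a).

(* [F_v = F_(v_0) \o ... \o F_(v_(n-1))] *)
Definition word_map (R : realType) (A : finType)
    (F : A -> circle R -> circle R) (v : seq A) : circle R -> circle R :=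
  foldr (fun a G => F a \o G) id v.

Definition Phi_rel (R : realType) (A : finType)
    (F : A -> circle R -> circle R) (w : infinite_word A) : set (circle R) :=
  [set x | represents (fun n => word_map F (word_prefix w n)) x].

(* [Phi F w] is meaningful only where [Phi_rel F w] is nonempty. *)
Definition Phi (R : realType) (A : finType) (F : A -> circle R -> circle R)
    (w : infinite_word A) : circle R :=
  get (Phi_rel F w).

Definition mobius_number_system (R : realType) (A : finType)
    (F : A -> circle R -> circle R) (S : set (infinite_word A)) :=
  [/\ subshift S,
      forall w, S w -> Phi_rel F w !=set0,
      Phi F @` S = setT
    & {within S, continuous (Phi F)}].

(* Main.v *)
Require Import Defs.
From HB Require Import structures.
From mathcomp Require Import all_boot all_order all_algebra.
From mathcomp Require Import all_classical all_reals all_analysis.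
From mathcomp Require Import complex measurable_realfun ring.

(** Self-similarity of the full shift contradicts continuity of [Phi].

    If the shift of [w] represents [x], then [w] represents the image of [x]
    under [F (w 0)] ([Phi_rel_shift]): a Moebius map acts
    continuously on the circle, so composing with it carries weak* convergence
    to [x] into weak* convergence to the image of [x] ([represents_comp]).
    Iterating, [Phi w] is [F_v (Phi w')] whenever [w] is the concatenation of
    the finite word [v] and of a word [w'] that represents a point.

    Suppose [Sigma] is the image of a full shift under [psi]. Words over [B] can
    be concatenated without any restriction, so after a prefix
    [v = psi (u_0) ... psi (u_(n-1))] every element of [Sigma] may follow, and
    the values of [Phi] on the words of [Sigma] that begin with [v] fill up
    [F_v (Phi Sigma)]. This is the whole circle, as [Phi] maps [Sigma] onto the
    circle and [F_v] is onto ([Phi_cylinder]). Hence every point [y] is the value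
    of [Phi] at words of [Sigma] arbitrarily close to [psi u]; by continuity
    [Phi (psi u) = y] for every [y], which is absurd since the circle has more
    than one point. *)

Import Order.TTheory GRing.Theory Num.Theory.
Import numFieldNormedType.Exports.
Import Defs.

Local Open Scope classical_set_scope.
Local Open Scope complex_scope.
Local Open Scope ring_scope.

Set Implicit Arguments.
Unset Strict Implicit.

(** * Topology of the circle and Moebius maps *)

Lemma continuous_circle_val (R : realType) :
  continuous (fun z : circle R => (z : R[i]) : R[i]^o).
Proof. exact: (@initial_continuous _ _ (@set_val _ (unit_circle R))). Qed.

(** The modulus takes its values in [R[i]]; its real part is needed because the
    test functions for weak* convergence are real-valued. *)
Definition circle_dist (R : realType) (x z : circle R) : R :=
  complex.Re `|(z : R[i]) - (x : R[i])|.

Lemma circle_distE (R : realType) (x z : circle R) :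
  (circle_dist x z)%:C = `|(z : R[i]) - (x : R[i])|.
Proof. by rewrite /circle_dist RRe_real// realE normr_ge0. Qed.

Lemma circle_dist_eq0 (R : realType) (x z : circle R) :
  circle_dist x z = 0 -> z = x.
Proof.
move=> d0; have /eqP := circle_distE x z.
rewrite d0 eq_sym normr_eq0 subr_eq0 => /eqP zx.
exact: val_inj.
Qed.

Lemma circle_distxx (R : realType) (x : circle R) : circle_dist x x = 0.
Proof. by rewrite /circle_dist subrr normr0. Qed.

Lemma continuous_circle_dist (R : realType) (x : circle R) :
  continuous (circle_dist x).
Proof.
(* The filters are explicit: unification would otherwise unfold neighbourhoods
   of [circle R] into those of the initial topology and miss their filter
   structure. *)
move=> z; apply: (iffRL
  (@cvgrPdist_lt _ R^o _ (nbhs z) (nbhs_filter z) _ _)) => e e0.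
have cz := @continuous_circle_val R z.
have /(_ e%:C) := iffLR
  (@cvgrPdist_lt _ R[i]^o _ (nbhs z) (nbhs_filter z) _ _) cz.
rewrite ltcR => /(_ e0) near_z; near=> t.
have tz : `|circle_val z - circle_val t| < e%:C by near: t.
have le_dist : `|circle_dist x z - circle_dist x t|%:C <=
    `|circle_val z - circle_val t|.
  rewrite /circle_dist -raddfB; apply: le_trans; first exact: normc_ge_Re.
  apply: le_trans; first exact: ler_dist_dist.
  by rewrite opprB addrA subrK.
by rewrite -ltcR; exact: le_lt_trans le_dist tz.
Unshelve. all: by end_near.
Qed.

Lemma cvg_homography (R : realType) (T : Type) (E : set_system T)
    (FE : Filter E) (f : T -> R[i]^o) (a b c d w : R[i]) :
  c * w + d != 0 -> f @ E --> (w : R[i]^o) ->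
  ((a * f t + b) / (c * f t + d) : R[i]^o) @[t --> E]
    --> ((a * w + b) / (c * w + d) : R[i]^o).
Proof.
move=> w0 fw.
have aff (k l : R[i]) :
    (k * f t + l : R[i]^o) @[t --> E] --> (k * w + l : R[i]^o).
  apply: (@cvgD R[i] R[i]^o _ E FE (fun t => k * f t) (fun=> l)).
    by apply: (@cvgM R[i] _ E FE (fun=> k) f); [exact: cvg_cst|exact: fw].
  exact: cvg_cst.
apply: (@cvgM R[i] _ E FE (fun t => a * f t + b)
  (fun t => (c * f t + d)^-1)); first exact: aff.
exact: (@cvgV R[i] _ E FE (fun t => c * f t + d) _ w0 (aff c d)).
Qed.

Lemma continuous_disc_mobius (R : realType) (F : circle R -> circle R) :
  disc_mobius F -> continuous F.
Proof.
move=> [a [b [ab1 FE]]].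
apply: (@continuous_comp_initial _ _ (R[i]^o) (@set_val _ (unit_circle R))).
have -> : @set_val _ (unit_circle R) \o F =
    (fun z : circle R => (a * z + b) / (b^*%C * z + a^*%C) : R[i]^o).
  by apply/funext => z; exact: FE.
move=> z; apply: (@cvg_homography R _ (nbhs z)).
  exact: mobius_denom_neq0.
exact: continuous_circle_val.
Qed.

(** The inverse of the map with coefficients [alpha], [beta] is the one with
    coefficients [alpha^*], [- beta]. *)
Lemma disc_mobius_surj (R : realType) (F : circle R -> circle R) :
  disc_mobius F -> forall y, exists x, F x = y.
Proof.
move=> [a [b [ab1 FE]]] y.
have ab1' : `|a^*%C| ^+ 2 - `|- b| ^+ 2 = 1 by rewrite normcJ normrN.
have [G GE] := disc_mobius_ex ab1'.
exists (G y); apply: val_inj; rewrite /= [LHS]FE GE.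
have d1 := mobius_denom_neq0 y ab1'.
have d2 := mobius_denom_neq0 (G y) ab1.
move: d2; rewrite GE.
move: d1 ab1; rewrite !sqr_normc conjcK rmorphN /= => d1 ab1 d2.
(* The denominators of the two maps multiply to [`|a| ^+ 2 - `|b| ^+ 2]. *)
have E : b^*%C * ((a^*%C * y - b) / (- b^*%C * y + a)) + a^*%C =
   (- b^*%C * y + a)^-1.
  apply: (mulIf d1); rewrite mulVf // -ab1 mulrDl -mulrA divfK //; ring.
rewrite E invrK mulrDl -mulrA divfK //.
transitivity ((a * a^*%C - b * b^*%C) * (y : R[i])); first ring.
by rewrite ab1 mul1r.
Qed.

(** * Weak* convergence to a point mass *)

Lemma measurable_continuous_circle (R : realType) (G : circle R -> circle R) :
  continuous G -> measurable_fun setT G.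
Proof.
move=> /continuousP cG.
apply: (@measurability _ _ _ _ _ _ (@open (circle R))) => //.
move=> _ [U oU <-]; rewrite setTI.
by apply: sub_sigma_algebra; exact: cG.
Qed.

Lemma measurable_continuous_circle_real (R : realType) (f : circle R -> R) :
  continuous f -> measurable_fun setT f.
Proof.
move=> /continuousP cf; apply: (measurability _ (RGenOpens.measurableE R)).
move=> _ [_ [a [b ->] <-]]; rewrite setTI.
by apply: sub_sigma_algebra; apply: cf; exact: interval_open.
Qed.

(** The formula is known for nonnegative functions; transferring the positive and
    the negative part separately makes both sides the same difference of
    extended reals, whether or not [f] is integrable. *)
Lemma integral_pushforwardT (d d' : measure_display) (X : measurableType d)
    (Y : measurableType d') (R : realType) (mu : {measure set X -> \bar R})
    (phi : X -> Y) (f : Y -> \bar R) :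
  measurable_fun setT phi -> measurable_fun setT f ->
  (\int[pushforward mu phi]_y f y = \int[mu]_x f (phi x))%E.
Proof.
move=> mphi mf.
(* The measure structure of the pushforward depends on the proof [mphi], which
   inference cannot find; hence the canonical instance by name. *)
have -> := integralE
  (measure_function_pushforward__canonical__measure_function_Measure mu mphi)
  setT f.
rewrite [RHS]integralE.
rewrite !(ge0_integral_pushforward mphi)//.
- by rewrite preimage_setT -(funepos_comp f) -(funeneg_comp f).
- exact: measurable_funeneg.
- exact: measurable_funepos.
Qed.

Lemma integral_pushforward_circle (R : realType) (G : circle R -> circle R)
    (f : circle R -> R) : continuous G -> continuous f ->
  (\int[pushforward (circle_prob R) G]_z (f z)%:E =
   \int[circle_prob R]_z (f (G z))%:E)%E.
Proof.
move=> cG cf; apply: (@integral_pushforwardT _ _ _ _ _ _ _ (EFin \o f)).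
  exact: measurable_continuous_circle.
by apply/measurable_EFinP; exact: measurable_continuous_circle_real.
Qed.

Lemma integral_dirac_circle (R : realType) (x : circle R) (f : circle R -> R) :
  continuous f -> (\int[\d_x]_z (f z)%:E = (f x)%:E)%E.
Proof.
move=> cf; rewrite integral_dirac// ?diracT ?mul1e//.
by apply/measurable_EFinP; exact: measurable_continuous_circle_real.
Qed.

(** Test functions separate points: the distance to [y] vanishes only at [y]. *)
Lemma represents_unique (R : realType) (G : nat -> circle R -> circle R)
    (x y : circle R) :
  represents G x -> represents G y -> x = y.
Proof.
move=> Gx Gy; have cx := @continuous_circle_dist R y.
have [] : ((circle_dist y x)%:E = (circle_dist y y)%:E)%E.
  rewrite -(integral_dirac_circle x cx) -(integral_dirac_circle y cx).
  by rewrite -(cvg_lim (@ereal_hausdorff R) (Gx _ cx))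
             -(cvg_lim (@ereal_hausdorff R) (Gy _ cx)).
by rewrite circle_distxx; exact: circle_dist_eq0.
Qed.

(** Testing [H \o G n] against [f] is testing [G n] against [f \o H], and the
    latter test function is again continuous. *)
Lemma represents_comp (R : realType) (H : circle R -> circle R)
    (G : nat -> circle R -> circle R) (x : circle R) :
  continuous H -> (forall n, continuous (G n)) ->
  represents G x -> represents (fun n => H \o G n) (H x).
Proof.
move=> cH cG Gx f cf.
have cfH : continuous (f \o H).
  by move=> z; apply: continuous_comp; [exact: cH|exact: cf].
have := Gx _ cfH; rewrite !integral_dirac_circle//.
under [X in X @ _ --> _]funext => n.
  rewrite (integral_pushforward_circle (cG n) cfH); over.
under [X in _ -> X @ _ --> _]funext => n.
  rewrite integral_pushforward_circle//; last first.
    by move=> z; apply: continuous_comp; [exact: cG|exact: cH].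
  over.
by [].
Qed.

(** * The value of a word and the value of its shift *)

Lemma word_prefixS (A : finType) (w : infinite_word A) n :
  word_prefix w n.+1 = w 0%N :: word_prefix (shift w) n.
Proof. by rewrite /word_prefix /mkseq /= -(addn0 1%N) iotaDl -map_comp. Qed.

Lemma iter_shiftE (A : finType) k (w : infinite_word A) i :
  iter k (@shift A) w i = w (i + k)%N.
Proof.
elim: k w i => [|k IH] w i; first by rewrite addn0.
by rewrite iterSr IH /shift addnS.
Qed.

Lemma continuous_word_map (R : realType) (A : finType)
    (F : A -> circle R -> circle R) (v : seq A) :
  mobius_iterative_system F -> continuous (word_map F v).
Proof.
move=> mF.
elim: v => [|a v IH] z; first exact: cvg_id.
apply: (@continuous_comp _ _ _ (word_map F v)); first exact: IH.
exact/continuous_disc_mobius/mF.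
Qed.

Lemma word_map_surj (R : realType) (A : finType)
    (F : A -> circle R -> circle R) (v : seq A) :
  mobius_iterative_system F -> forall y, exists x, word_map F v x = y.
Proof.
move=> mF y.
elim: v y => [|a v IH] y; first by exists y.
have [z <-] := disc_mobius_surj (mF a) y.
by have [x <-] := IH z; exists x.
Qed.

Lemma Phi_relE (R : realType) (A : finType)
    (F : A -> circle R -> circle R) (w : infinite_word A) (x : circle R) :
  Phi_rel F w x -> Phi F w = x.
Proof.
move=> wx; apply: (represents_unique _ wx).
by rewrite /Phi; apply: getPex; exists x.
Qed.

(** The maps of [w] are those of its shift, one index later and composed on the
    left with the first map. *)
Lemma Phi_rel_shift (R : realType) (A : finType)
    (F : A -> circle R -> circle R) (w : infinite_word A) (x : circle R) :
  mobius_iterative_system F ->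
  Phi_rel F (shift w) x -> Phi_rel F w (F (w 0%N) x).
Proof.
move=> mF sx f cf.
have cFa : continuous (F (w 0%N)) by exact/continuous_disc_mobius/mF.
rewrite -(cvg_shiftS (fun n =>
  \int[pushforward (circle_prob R) (word_map F (word_prefix w n))]_z
    (f z)%:E)%E).
rewrite [X in X @ _ --> _](_ : _ = fun n => (\int[pushforward (circle_prob R)
    (F (w 0%N) \o word_map F (word_prefix (shift w) n))]_z (f z)%:E)%E).
  have cG n : continuous (word_map F (word_prefix (shift w) n)).
    exact: continuous_word_map.
  exact: (represents_comp cFa cG sx cf).
by apply/funext => n; rewrite /mk_sequence word_prefixS.
Qed.

Lemma Phi_rel_iter_shift (R : realType) (A : finType)
    (F : A -> circle R -> circle R) (n : nat)
    (w : infinite_word A) (x : circle R) :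
  mobius_iterative_system F ->
  Phi_rel F (iter n (@shift A) w) x ->
  Phi_rel F w (word_map F (word_prefix w n) x).
Proof.
move=> mF; elim: n w => [//|n IH] w; rewrite iterSr => /IH.
by rewrite word_prefixS; exact: Phi_rel_shift.
Qed.

(** * Substitutions and shifts *)

Section Substitution.
Context (A B : finType) (psi : B -> nonempty_word A).

Definition psi_prefix (u : infinite_word B) (n : nat) : seq A :=
  flatten [seq val (psi b) | b <- word_prefix u n].

(** Removing [psi (u 0)] from [psi u] leaves the image of the shift of [u]. The
    two sides read a letter with different default values of [nth], which are
    irrelevant as the index lies inside the word. *)
Lemma shift_substitution_map (u : infinite_word B) :
  iter (size (val (psi (u 0%N)))) (@shift A) (substitution_map psi u) =
  substitution_map psi (shift u).
Proof.
apply/funext => i; rewrite iter_shiftE.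
have [iV _] := substitution_map_prefix psi (shift u) i.+1.
have [_] := substitution_map_prefix psi u i.+2.
rewrite -/(psi_prefix (shift u) i.+1) in iV.
rewrite word_prefixS /= -/(psi_prefix (shift u) i.+1) => prefixE.
have := congr1 (nth (first_letter (psi (u 0%N))) ^~
  (i + size (val (psi (u 0%N))))%N) prefixE.
rewrite /= nth_mkseq; last by rewrite size_cat addnC ltn_add2l.
rewrite nth_cat ltnNge leq_addl /= addnK => ->.
exact: set_nth_default.
Qed.

Lemma iter_shift_substitution_map (u : infinite_word B) n :
  iter (size (psi_prefix u n)) (@shift A) (substitution_map psi u) =
  substitution_map psi (iter n (@shift B) u).
Proof.
elim: n u => [//|n IH] u.
rewrite /psi_prefix word_prefixS /= size_cat addnC iterD shift_substitution_map.
by rewrite -/(psi_prefix (shift u) n) IH -iterSr.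
Qed.

End Substitution.

Lemma cvg_infinite_word (A : finType) (v : nat -> infinite_word A)
    (w : infinite_word A) :
  (forall n, word_prefix (v n) n = word_prefix w n) -> v @ \oo --> w.
Proof.
move=> vw; apply/(pointwise_cvgP (V := discrete_topology A)) => i.
apply: cvg_near_cst; exists i.+1 => // n /= ni.
have := congr1 (fun s => nth (w i) s i) (vw n).
by rewrite !nth_mkseq.
Qed.

(** * Cylinders in the image of a full shift *)

(** Let [v] be the prefix [psi (u_0) ... psi (u_(n-1))] of [psi u]. As [F_v] is
    onto, [y = F_v x] for some [x], and [x] is the value of [Phi] at some
    [psi u']. The word obtained from [psi u'] by putting [v] in front is the
    image under [psi] of [u_0 ... u_(n-1) u'], hence again in [Sigma]; its value
    is [F_v x = y]. *)
Lemma Phi_cylinder (R : realType) (A B : finType)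
    (F : A -> circle R -> circle R) (Sigma : set (infinite_word A))
    (psi : B -> nonempty_word A) (u : infinite_word B) (n : nat)
    (y : circle R) :
  mobius_iterative_system F -> mobius_number_system F Sigma ->
  Sigma = substitution_map psi @` [set: infinite_word B] ->
  exists2 w, Sigma w &
    word_prefix w n = word_prefix (substitution_map psi u) n /\ Phi F w = y.
Proof.
move=> mF [_ dPhi sPhi _] SE.
have [x xy] := word_map_surj (psi_prefix psi u n) mF y.
have : [set: circle R] x by [].
rewrite -sPhi => -[w' Sw' w'x].
have : Sigma w' by []; rewrite {1}SE => -[u' _ u'w'].
pose v : infinite_word B := fun i => if (i < n)%N then u i else u' (i - n)%N.
have vn : word_prefix v n = word_prefix u n.
  by apply/eq_in_map => i; rewrite mem_iota /= add0n => i_n; rewrite /v i_n.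
have bvn : psi_prefix psi v n = psi_prefix psi u n by rewrite /psi_prefix vn.
have iter_v : iter n (@shift B) v = u'.
  apply/funext => i; rewrite iter_shiftE /v.
  by rewrite ltnNge leq_addl /= addnK.
exists (substitution_map psi v); first by rewrite SE; exists v.
have [nb bu] := substitution_map_prefix psi u n.
have [_ bv] := substitution_map_prefix psi v n.
rewrite -/(psi_prefix psi u n) in nb bu.
rewrite -/(psi_prefix psi v n) bvn in bv.
split.
  have take_prefix (w : infinite_word A) m : (n <= m)%N ->
      word_prefix w n = take n (word_prefix w m).
    move=> nm.
    by rewrite /word_prefix /mkseq -map_take take_iota (minn_idPl nm).
  by rewrite !(take_prefix _ _ nb) bu bv.
apply: Phi_relE.
rewrite -xy -bv; apply: Phi_rel_iter_shift => //.
rewrite -{1}bvn iter_shift_substitution_map iter_v u'w'.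
have [z w'z] := dPhi _ Sw'.
by rewrite -w'x (Phi_relE w'z).
Qed.

Theorem theorem36 (R : realType) (A : finType)
    (F : A -> circle R -> circle R) (Sigma : set (infinite_word A)) :
  mobius_iterative_system F -> mobius_number_system F Sigma ->
  forall (B : finType) (psi : B -> nonempty_word A),
    Sigma <> substitution_map psi @` [set: infinite_word B].
Proof.
move=> mF mns B psi SE.
have [_ _ sPhi /subspace_continuousP cPhi] := mns.
have : [set: circle R] point by [].
rewrite -sPhi => -[w Sw _]; have := Sw; rewrite {1}SE => -[u _ uw].
(* [y] is the value of [Phi] at words [v n] of [Sigma] tending to [w]. *)
have all_eq y : y = Phi F w.
  have /choice[v vP] : forall n, exists w', [/\ Sigma w',
      word_prefix w' n = word_prefix w n & Phi F w' = y].
    move=> n; have [w' Sw' [w'w Phiw']] := Phi_cylinder u n y mF mns SE.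
    by exists w'; split=> //; rewrite w'w uw.
  have vw : v @ \oo --> w by apply: cvg_infinite_word => n; have [] := vP n.
  have vSw : v @ \oo --> within Sigma (nbhs w).
    move=> U wU; have := vw _ wU; apply: (@filterS _ \oo) => n; apply.
    by have [] := vP n.
  have Phi_cvg := cvg_comp _ _ vSw (cPhi w Sw).
  have Phiv : Phi F \o v = fun=> y by apply/funext => n; have [] := vP n.
  rewrite Phiv in Phi_cvg.
  have dist_cvg : circle_dist y y @[_ --> \oo] --> circle_dist y (Phi F w).
    exact: cvg_comp _ _ Phi_cvg (@continuous_circle_dist R y (Phi F w)).
  apply/esym/circle_dist_eq0.
  rewrite -(cvg_lim (@Rhausdorff R) dist_cvg) -[RHS](circle_distxx y).
  by apply: lim_cst; exact: Rhausdorff.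
have : Circle (normr1 R[i]) = Circle (normrN1 R[i]).
  by rewrite [LHS]all_eq [RHS]all_eq.
move/(congr1 (@circle_val R))/eqP.
by rewrite /= eq_sym eqNr oner_eq0.
Qed.
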